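(* Let $A=\begin{bmatrix}a&b&c\\ f&g&h\\ p&q&r\end{bmatrix}\in\mathcal{M}(3,\mathbb{H})$ be a quaternionic matrix with $c\neq0$, and put $\lambda_0=g-hc^{-1}b$, $f_0=f-hc^{-1}(a-\lambda_0)$, $q_0=q-(r-\lambda_0)c^{-1}b$. Define $\mu\colon\mathcal{M}(3,\mathbb{H})\to\mathcal{M}(3,\mathbb{H})$ as follows: 1. if $\lambda_0I-B$ is not invertible, then $\mu(B)=q_0f_0I$; 2. if $\lambda_0I-B$ is invertible, then $$\mu(B)=(\lambda_0I-B)\Big[\big(pI-(rI-B)c^{-1}(aI-B)\big)-\big(qI-(rI-B)c^{-1}b\big)(\lambda_0I-B)^{-1}\big(fI-hc^{-1}(aI-B)\big)\Big].$$ Then $\mu$ satisfies the Hamilton-Cayley theorem, that is, $\mu(A)=0$.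
   Context: $\mathbb{H}$ is the algebra of quaternions, $\mathcal{M}(3,\mathbb{H})$ the set of $3\times3$ quaternionic matrices, $I$ the identity matrix. A quaternion $s$ multiplying a matrix on the left or on the right stands for the matrix $sI$. (The map $\mu$ extends to matrices the characteristic function the paper associates with $A$ when $c\neq0$.) *)

(* Defs.v *)
From HB Require Import structures.
From mathcomp Require Import all_boot all_order all_algebra.
From mathcomp Require Import boolp reals.
From mathcomp Require Import ring.

Set Implicit Arguments.
Unset Strict Implicit.
Unset Printing Implicit Defensive.

Import Order.TTheory GRing.Theory Num.Theory.
Local Open Scope ring_scope.

(* [Quaternion x y z t] stands for x + y i + z j + t k. *)
Record quaternion (R : Type) : Type :=
  Quaternion { qre : R; qi : R; qj : R; qk : R }.

Section QuaternionEncoding.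
Variable R : Type.

Definition tuple_of_quaternion (u : quaternion R) : R * R * R * R :=
  (qre u, qi u, qj u, qk u).

Definition quaternion_of_tuple (t : R * R * R * R) : quaternion R :=
  let: (x, y, z, w) := t in Quaternion x y z w.

Lemma tuple_of_quaternionK : cancel tuple_of_quaternion quaternion_of_tuple.
Proof. by case. Qed.

End QuaternionEncoding.

HB.instance Definition _ (R : eqType) :=
  Equality.copy (quaternion R) (can_type (@tuple_of_quaternionK R)).
HB.instance Definition _ (R : choiceType) :=
  Choice.copy (quaternion R) (can_type (@tuple_of_quaternionK R)).

Section QuaternionRing.
Variable R : realFieldType.
Implicit Types u v w : quaternion R.

Definition qzero : quaternion R := Quaternion 0 0 0 0.
Definition qone : quaternion R := Quaternion 1 0 0 0.
Definition qopp u : quaternion R :=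
  Quaternion (- qre u) (- qi u) (- qj u) (- qk u).
Definition qadd u v : quaternion R :=
  Quaternion (qre u + qre v) (qi u + qi v) (qj u + qj v) (qk u + qk v).

(* i^2 = j^2 = k^2 = ijk = -1 *)
Definition qmul u v : quaternion R :=
  Quaternion
    (qre u * qre v - qi u * qi v - qj u * qj v - qk u * qk v)
    (qre u * qi v + qi u * qre v + qj u * qk v - qk u * qj v)
    (qre u * qj v - qi u * qk v + qj u * qre v + qk u * qi v)
    (qre u * qk v + qi u * qj v - qj u * qi v + qk u * qre v).

Definition qsqnorm u : R := qre u ^+ 2 + qi u ^+ 2 + qj u ^+ 2 + qk u ^+ 2.

Definition qinv u : quaternion R :=
  Quaternion (qre u / qsqnorm u) (- qi u / qsqnorm u)
             (- qj u / qsqnorm u) (- qk u / qsqnorm u).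

Lemma quaternion_eq u v :
  qre u = qre v -> qi u = qi v -> qj u = qj v -> qk u = qk v -> u = v.
Proof. by case: u v => [? ? ? ?] [? ? ? ?] /= -> -> -> ->. Qed.

Lemma qaddA : associative qadd.
Proof. by move=> u v w; apply: quaternion_eq => /=; ring. Qed.
Lemma qaddC : commutative qadd.
Proof. by move=> u v; apply: quaternion_eq => /=; ring. Qed.
Lemma qadd0 : left_id qzero qadd.
Proof. by move=> u; apply: quaternion_eq => /=; ring. Qed.
Lemma qaddN : left_inverse qzero qopp qadd.
Proof. by move=> u; apply: quaternion_eq => /=; ring. Qed.

HB.instance Definition _ :=
  GRing.isZmodule.Build (quaternion R) qaddA qaddC qadd0 qaddN.

Lemma qmulA : associative qmul.
Proof. by move=> u v w; apply: quaternion_eq => /=; ring. Qed.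
Lemma qmul1l : left_id qone qmul.
Proof. by move=> u; apply: quaternion_eq => /=; ring. Qed.
Lemma qmul1r : right_id qone qmul.
Proof. by move=> u; apply: quaternion_eq => /=; ring. Qed.
Lemma qmulDl : left_distributive qmul +%R.
Proof. by move=> u v w; apply: quaternion_eq => /=; ring. Qed.
Lemma qmulDr : right_distributive qmul +%R.
Proof. by move=> u v w; apply: quaternion_eq => /=; ring. Qed.
Lemma qone_neq0 : qone != 0.
Proof. by apply/eqP => -[] /eqP; rewrite oner_eq0. Qed.

HB.instance Definition _ := GRing.Zmodule_isNzRing.Build (quaternion R)
  qmulA qmul1l qmul1r qmulDl qmulDr qone_neq0.

Lemma qsqnorm_neq0 u : u != 0 -> qsqnorm u != 0.
Proof.
apply: contraNneq => /eqP.
rewrite /qsqnorm !paddr_eq0 ?addr_ge0 ?sqr_ge0// !sqrf_eq0 -!andbA.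
by case/and4P => /eqP ? /eqP ? /eqP ? /eqP ?; apply/eqP/quaternion_eq.
Qed.

Definition qunit : pred (quaternion R) := fun u => u != 0.

Lemma qmulVr : {in qunit, left_inverse 1 qinv *%R}.
Proof.
move=> u /qsqnorm_neq0; rewrite /qsqnorm => nz.
by apply: quaternion_eq; rewrite /= /qsqnorm; field.
Qed.

Lemma qmulrV : {in qunit, right_inverse 1 qinv *%R}.
Proof.
move=> u /qsqnorm_neq0; rewrite /qsqnorm => nz.
by apply: quaternion_eq; rewrite /= /qsqnorm; field.
Qed.

Lemma qunitP u v : v * u = 1 /\ u * v = 1 -> qunit u.
Proof.
by case=> _; apply: contra_eq_neq => ->; rewrite mul0r eq_sym oner_neq0.
Qed.

Lemma qinv_out : {in [predC qunit], qinv =1 id}.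
Proof.
move=> u /negPn/eqP ->.
by apply: quaternion_eq => /=; rewrite ?oppr0 mul0r.
Qed.

HB.instance Definition _ := GRing.NzRing_hasMulInverse.Build (quaternion R)
  qmulVr qmulrV qunitP qinv_out.

End QuaternionRing.

(* MathComp's [unitmx] and [invmx] require a commutative coefficient ring,
   hence the following two-sided notions. *)
Section Inverse.
Variables (R : nzRingType) (n : nat).
Implicit Types B C : 'M[R]_n.+1.

Definition is_inverse B C : Prop := B * C = 1 /\ C * B = 1.

Definition invertible B : Prop := exists C, is_inverse B C.

(* Equal to 0 when [B] is not invertible. *)
Definition inverse B : 'M[R]_n.+1 :=
  if pselect (invertible B) is left invB then projT1 (cid invB) else 0.

Lemma inverseP B : invertible B -> is_inverse B (inverse B).
Proof.
by rewrite /inverse; case: pselect => // invB _; exact: (projT2 (cid invB)).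
Qed.

End Inverse.

Definition mx3 (T : nzRingType) (a b c f g h p q r : T) : 'M[T]_3 :=
  \matrix_(i < 3, j < 3)
    nth 0 (nth [::] [:: [:: a; b; c]; [:: f; g; h]; [:: p; q; r]] i) j.

Definition mu (R : realType) (a b c f g h p q r : quaternion R)
    (B : 'M[quaternion R]_3) : 'M[quaternion R]_3 :=
  let lambda0 := g - h * c^-1 * b in
  let f0 := f - h * c^-1 * (a - lambda0) in
  let q0 := q - (r - lambda0) * c^-1 * b in
  if `[< invertible (lambda0%:M - B) >] then
    (lambda0%:M - B) *
      ((p%:M - (r%:M - B) * c^-1%:M * (a%:M - B))
       - (q%:M - (r%:M - B) * (c^-1 * b)%:M) * inverse (lambda0%:M - B)
         * (f%:M - (h * c^-1)%:M * (a%:M - B)))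
  else (q0 * f0)%:M.

(* Main.v *)
(** Put N = lambda0 I - A, alpha = a - lambda0, rho = r - lambda0, d = c^-1.
    Subtracting hd times the first row of N from the second leaves
    (-f0, 0, 0), and N is invertible exactly when f0 and q0 are nonzero; so
    q0 f0 = 0 in the singular case.  In the other case the bracket is
    P - Q N^-1 F, where
      P = p - (rho + N) d (alpha + N),  Q = q0 - N d b,  F = f0 - h d N.
    Let X = N^-1 F.  The same row combination, applied to N X = F, shows that
    the first row of X is -e2; then P = Q X reads
    N W = q0 X - p + rho d (alpha + N) with W = d (b X - alpha - N), and the
    first two rows of W are e3 and minus the third row of X, which reduces
    this equation to the rows of N X = F. *)
Require Import Defs.
From mathcomp Require Import all_boot all_order all_algebra.
From mathcomp Require Import boolp reals.

Set Implicit Arguments.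
Unset Strict Implicit.
Unset Printing Implicit Defensive.

Import GRing.Theory.
Local Open Scope ring_scope.

Local Notation i0 := (Ordinal (isT : (0 < 3)%N)).
Local Notation i1 := (Ordinal (isT : (1 < 3)%N)).
Local Notation i2 := (Ordinal (isT : (2 < 3)%N)).

Section Matrix3.
Variable T : nzRingType.

Lemma ord3P (P : 'I_3 -> Prop) : P i0 -> P i1 -> P i2 -> forall i, P i.
Proof.
move=> P0 P1 P2 [[|[|[|//]]] lt_i3].
- by rewrite (bool_irrelevance lt_i3 isT).
- by rewrite (bool_irrelevance lt_i3 isT).
- by rewrite (bool_irrelevance lt_i3 isT).
Qed.

Lemma mulmx3E (M N : 'M[T]_3) i j :
  (M * N) i j = M i i0 * N i0 j + M i i1 * N i1 j + M i i2 * N i2 j.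
Proof.
rewrite mxE !big_ord_recl big_ord0 addr0 addrA.
by congr (_ * _ + _ * _ + _ * _); congr (fun_of_matrix _ _ _); apply: val_inj.
Qed.

Lemma mxE_sub m n (M N : 'M[T]_(m, n)) i j : (M - N) i j = M i j - N i j.
Proof. by rewrite !mxE. Qed.

Lemma mxE_scalar_mul n (s : T) (M : 'M[T]_n.+1) i j :
  (s%:M * M) i j = s * M i j.
Proof. by rewrite [_ * _]mul_scalar_mx mxE. Qed.

(** Expressing entries through those of the identity lets whole rows be compared with the column [j]
    left arbitrary. *)
Lemma scalar_mxE1 n (s : T) (i j : 'I_n.+1) :
  s%:M i j = s * (1 : 'M[T]_n.+1) i j.
Proof. by rewrite -mxE_scalar_mul mulr1. Qed.

End Matrix3.

Section Reduced.
Variable T : unitRingType.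
Variables alpha b c f0 h p q0 rho : T.
Hypothesis cu : c \is a GRing.unit.
Let d := c^-1.

(* [lambda0 I - A], written in terms of [alpha = a - lambda0],
   [rho = r - lambda0], [f0] and [q0]. *)
Definition reduced : 'M[T]_3 :=
  - mx3 alpha b c
        (f0 + h * c^-1 * alpha) (h * c^-1 * b) h
        p (q0 + rho * c^-1 * b) rho.

Let N := reduced.

Lemma reduced_row0 M j :
  (N * M) i0 j = - (alpha * M i0 j) - (b * M i1 j + c * M i2 j).
Proof. by rewrite mulmx3E !mxE /= !mulNr opprD addrA. Qed.

Lemma reduced_row1 M j :
  (N * M) i1 j = h * d * (N * M) i0 j - f0 * M i0 j.
Proof.
rewrite reduced_row0 mulmx3E !mxE /= !mulNr mulrDl mulrBr mulrN.
rewrite mulrDr !mulrA mulrVK// opprD -/d.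
by rewrite opprD !addrA [RHS]addrC !addrA.
Qed.

(** Since [rho = rho * d * c], the combination [b * M i1 j + c * M i2 j] of row 0 reappears and can
    be handled as one unknown. *)
Lemma reduced_row2 M j :
  (N * M) i2 j = - (p * M i0 j) - q0 * M i1 j
    - rho * d * (b * M i1 j + c * M i2 j).
Proof.
rewrite mulmx3E !mxE /= !mulNr mulrDl mulrDr !mulrA mulrVK// -/d.
by rewrite !opprD !addrA.
Qed.

(** With [f0 = 0], row 1 of [N * C] would be [h * d] times row 0; in column 1 of the identity this
    reads 1 = 0. *)
Lemma reduced_right_inv_f0_neq0 C : N * C = 1 -> f0 <> 0.
Proof.
move=> NC1 f00; have := reduced_row1 C i1.
rewrite NC1 f00 mul0r subr0 !mxE /= mulr0 => /eqP.
by rewrite oner_eq0.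
Qed.

(** A right inverse [C] is found column by column; as [N * (C * N - 1) = 0], injectivity of left
    multiplication by [N] makes it two-sided. *)
Lemma reduced_invertible : f0 \is a GRing.unit -> q0 \is a GRing.unit ->
  invertible N.
Proof.
move=> f0u q0u.
have inj Y : N * Y = 0 -> Y = 0.
  move=> NY0.
  have E i j : (N * Y) i j = 0 by rewrite NY0 mxE.
  have Y0 j : Y i0 j = 0.
    have := reduced_row1 Y j; rewrite !E mulr0 sub0r => /esym/eqP.
    by rewrite oppr_eq0 mulrI_eq0; [move/eqP | exact: mulrI].
  have bc j : b * Y i1 j + c * Y i2 j = 0.
    have := reduced_row0 Y j; rewrite E Y0 mulr0 oppr0 sub0r => /esym/eqP.
    by rewrite oppr_eq0 => /eqP.
  have Y1 j : Y i1 j = 0.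
    have := reduced_row2 Y j.
    rewrite E Y0 bc !mulr0 oppr0 addr0 add0r => /esym/eqP.
    by rewrite oppr_eq0 mulrI_eq0; [move/eqP | exact: mulrI].
  have Y2 j : Y i2 j = 0.
    have := bc j; rewrite Y1 mulr0 add0r => /eqP.
    by rewrite mulrI_eq0; [move/eqP | exact: mulrI].
  by apply/matrixP => i j; rewrite [RHS]mxE; move: i; apply: ord3P.
(* Substitution in [N x = e]: row 1 gives [x1], row 0 gives [u = b x2 + c x3], row 2 gives [x2], and
   [u] then yields [x3]. *)
pose x1 (e : 'cV[T]_3) := f0^-1 * (h * d * e i0 0 - e i1 0).
pose u e := - (alpha * x1 e + e i0 0).
pose x2 e := q0^-1 * - (p * x1 e + rho * d * u e + e i2 0).
pose x3 e := d * (u e - b * x2 e).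
pose C : 'M[T]_3 := \matrix_(i, j)
  nth 0 [:: x1 (col j 1); x2 (col j 1); x3 (col j 1)] i.
have uE e : b * x2 e + c * x3 e = u e.
  by rewrite /x3 mulrA divrr// mul1r addrC subrK.
have NC : N * C = 1.
  have r0 j : (N * C) i0 j = (1 : 'M_3) i0 j.
    rewrite reduced_row0 !mxE /= uE /u opprK addrA addNr add0r.
    by rewrite !mxE.
  have r1 j : (N * C) i1 j = (1 : 'M_3) i1 j.
    rewrite reduced_row1 r0 !mxE /= /x1 mulVKr// !mxE /=.
    by rewrite subKr.
  have r2 j : (N * C) i2 j = (1 : 'M_3) i2 j.
    rewrite reduced_row2 !mxE /= uE /x2 mulVKr// opprK.
    by rewrite -!addrA addKr addrCA subrr addr0 !mxE.
  by apply/matrixP => i j; move: i; apply: ord3P.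
exists C; split=> //; apply/eqP; rewrite -subr_eq0; apply/eqP/inj.
by rewrite mulrBr mulrA NC mul1r mulr1 subrr.
Qed.

Lemma reduced_bracket X : f0 \is a GRing.unit ->
  N * X = f0%:M - (h * d)%:M * N ->
  p%:M - (rho%:M + N) * d%:M * (alpha%:M + N) = (q0%:M - N * (d * b)%:M) * X.
Proof.
move=> f0u NX.
have E i j : (N * X) i j = f0 * (1 : 'M_3) i j - h * d * N i j.
  by rewrite NX mxE_sub mxE_scalar_mul scalar_mxE1.
have n0 j : alpha * (1 : 'M_3) i0 j + N i0 j =
    - (b * (1 : 'M_3) i1 j + c * (1 : 'M_3) i2 j).
  by rewrite -[N]mulr1 reduced_row0 addrA subrr add0r.
have n1 j : N i1 j = h * d * N i0 j - f0 * (1 : 'M_3) i0 j.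
  by have := reduced_row1 1 j; rewrite mulr1.
have n2 j : N i2 j = - (p * (1 : 'M_3) i0 j) - q0 * (1 : 'M_3) i1 j
    - rho * d * (b * (1 : 'M_3) i1 j + c * (1 : 'M_3) i2 j).
  by have := reduced_row2 1 j; rewrite mulr1.
(* In row 1 of [N X = F], the [h * d] terms cancel by [n1]. *)
have X0 j : X i0 j = - (1 : 'M_3) i1 j.
  apply: (mulrI f0u); rewrite mulrN.
  have := reduced_row1 X j; rewrite !E n1 !mulrBr opprB [LHS]addrC.
  by move=> /addrI ->; rewrite opprK.
have X12 j : b * X i1 j + c * X i2 j = alpha * (1 : 'M_3) i1 j + N i1 j.
  have := reduced_row0 X j; rewrite E X0 mulrN opprK n1 => E0.
  by rewrite -(opprB (f0 * _)) E0 subKr.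
(* [W] collects the terms of [P = Q X] that have [N] as left factor. *)
pose W := (d * b)%:M * X - d%:M * (alpha%:M + N).
have WE i j : W i j = d * (b * X i j - (alpha * (1 : 'M_3) i j + N i j)).
  rewrite mxE_sub !mxE_scalar_mul mxE scalar_mxE1.
  by rewrite mulrBr mulrA.
have W0 j : W i0 j = (1 : 'M_3) i2 j.
  by rewrite WE X0 n0 mulrN opprK addrA addNr add0r mulKr.
have W1 j : W i1 j = - X i2 j.
  by rewrite WE -X12 opprD addrA subrr sub0r mulrN mulKr.
have W12 j : b * W i1 j + c * W i2 j = - (alpha * (1 : 'M_3) i2 j + N i2 j).
  by rewrite W1 WE mulVKr// mulrN addKr.
suff NW : N * W = q0%:M * X - p%:M + rho%:M * (d%:M * (alpha%:M + N)).
  move: NW; rewrite /W mulrBr => /(canRL (subrK _)) NdbX.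
  rewrite [RHS]mulrBl -[N * _ * X]mulrA NdbX mulrDl mulrDl -!mulrA.
  rewrite -[X in _ = _ - X]addrA [in RHS]opprD.
  by rewrite opprB addrA [q0%:M * X + _]addrC subrK.
have RE i j : (q0%:M * X - p%:M + rho%:M * (d%:M * (alpha%:M + N))) i j =
    q0 * X i j - p * (1 : 'M_3) i j
      + rho * d * (alpha * (1 : 'M_3) i j + N i j).
  rewrite mxE mxE_sub !mxE_scalar_mul [(alpha%:M + N) i j]mxE.
  by rewrite (scalar_mxE1 p) (scalar_mxE1 alpha) mulrA.
(* Row 0 reduces to the third row of [N], row 1 to minus the third row of [N X = F], and row 2 to
   [reduced_row2] applied to [W]. *)
apply/matrixP => i j; rewrite RE; move: i; apply: ord3P.
- rewrite reduced_row0 W12 W0 opprK addKr n2 X0 n0 !mulrN.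
  by congr (_ + _); exact: addrC.
- rewrite reduced_row1 reduced_row0 W12 W0 opprK addKr -[LHS]opprB -E.
  by rewrite reduced_row2 X0 X12 mulrN opprK !opprB addrC.
- rewrite reduced_row2 W12 W0 W1 !mulrN !opprK.
  by congr (_ + _); exact: addrC.
Qed.

End Reduced.

Theorem proposition6p9 (R : realType) (a b c f g h p q r : quaternion R)
  (hc : c != 0) :
  mu a b c f g h p q r (mx3 a b c f g h p q r) = 0.
Proof.
rewrite /mu; set l0 := g - _; set f0 := f - _; set q0 := q - _.
set A := mx3 _ _ _ _ _ _ _ _ _.
pose N := reduced (a - l0) b c f0 h p q0 (r - l0).
have eN : l0%:M - A = N.
  apply/matrixP; apply: ord3P; apply: ord3P;
    rewrite !mxE /= ?mulr1n ?mulr0n ?sub0r//.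
  - by rewrite opprB.
  - by rewrite /f0 subrK.
  - by rewrite /l0 addrAC subrr sub0r.
  - by rewrite /q0 subrK.
  - by rewrite opprB.
have shift s : s%:M - A = (s - l0)%:M + N.
  by rewrite -eN raddfB /= addrA subrK.
rewrite eN; case: asboolP => [invN|ninvN]; last first.
  have [->|q0n] := eqVneq q0 0; first by rewrite mul0r raddf0.
  have [->|f0n] := eqVneq f0 0; first by rewrite mulr0 raddf0.
  (* Nonzero quaternions are units by definition, so [hc], [f0n] and [q0n] are the unit
     hypotheses. *)
  by case: ninvN; apply: reduced_invertible.
have [NV _] := inverseP invN.
have f0u : f0 \is a GRing.unit.
  by apply/eqP; apply: reduced_right_inv_f0_neq0 NV.
rewrite !shift.
have -> : f%:M - (h * c^-1)%:M * ((a - l0)%:M + N) =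
    f0%:M - (h * c^-1)%:M * N.
  by rewrite mulrDr opprD addrA -[_%:M * _%:M]scalar_mxM [(f - _)%:M]raddfB.
have -> : q%:M - ((r - l0)%:M + N) * (c^-1 * b)%:M =
    q0%:M - N * (c^-1 * b)%:M.
  by rewrite mulrDl opprD addrA -[_%:M * _%:M]scalar_mxM mulrA [(q - _)%:M]raddfB.
rewrite -[_ * inverse N * _]mulrA -reduced_bracket// ?subrr ?mulr0//.
by rewrite mulrA NV mul1r.
Qed.
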